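(* There are universal Martin-Löf tests $\mathcal U$ and $\mathcal W$ and a function $F$ (defined on $\mathrm{MLR}$) that is exactly $\mathcal U$-layerwise computable but not exactly $\mathcal W$-layerwise computable.
   Context: Work in Cantor space $2^\omega$ with Lebesgue measure $\lambda$. For $\sigma\in 2^{<\omega}$, $[\sigma]=\{X\in 2^\omega:\sigma\prec X\}$. A sequence $(\mathcal U_i)_{i\in\omega}$ of open subsets of $2^\omega$ is uniformly effectively open if $\{\langle i,\sigma\rangle : [\sigma]\subseteq\mathcal U_i\}$ is computably enumerable. A Martin-Löf (ML) test is a uniformly effectively open sequence $(\mathcal V_i)_{i\in\omega}$ with $\lambda(\mathcal V_i)\le 2^{-i}$; it is universal if $\bigcap_i\mathcal V'_i\subseteq\bigcap_i\mathcal V_i$ for every ML-test $\mathcal V'$. $\mathrm{MLR}$ is the set of Martin-Löf random sequences, which for universal $\mathcal U$ equals $2^\omega\setminus\bigcap_i\mathcal U_i$; for $X\in\mathrm{MLR}$, $\mathrm{rd}_{\mathcal U}(X)=\min\{i:X\notin\mathcal U_i\}$. Functions take values in $2^\omega$ or in $\omega$ (a number $n$ coded by the characteristic function of $\{n\}$). A function $f$ (defined at least on $\mathrm{MLR}$) is exactly $\mathcal U$-layerwise computable if there is a Turing functional $\Phi$ with $\Phi(\langle X,\mathrm{rd}_{\mathcal U}(X)\rangle)=f(X)$ for all $X\in\mathrm{MLR}$. *)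

(* Defs.v *)
From Stdlib Require Import Arith List.
Import ListNotations.

Definition pair (a b : nat) : nat := (a + b) * (a + b + 1) / 2 + b.

Inductive code : Type :=
| Zero | Succ | Id | Fst | Snd
| Orc
| Pair (f g : code)
| Comp (f g : code)
| Prec (f g : code)
| Mu (f : code).

Inductive eval (O : nat -> bool) : code -> nat -> nat -> Prop :=
| ev_zero x : eval O Zero x 0
| ev_succ x : eval O Succ x (S x)
| ev_id x : eval O Id x x
| ev_fst a b : eval O Fst (pair a b) a
| ev_snd a b : eval O Snd (pair a b) b
| ev_orc x : eval O Orc x (if O x then 1 else 0)
| ev_pair f g x a b : eval O f x a -> eval O g x b -> eval O (Pair f g) x (pair a b)
| ev_comp f g x y z : eval O g x y -> eval O f y z -> eval O (Comp f g) x z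
| ev_prec0 f g x y : eval O f x y -> eval O (Prec f g) (pair x 0) y
| ev_precS f g x n y z :
    eval O (Prec f g) (pair x n) y -> eval O g (pair x (pair n y)) z ->
    eval O (Prec f g) (pair x (S n)) z
| ev_mu f x n :
    eval O f (pair x n) 0 ->
    (forall m, m < n -> exists v, v <> 0 /\ eval O f (pair x m) v) ->
    eval O (Mu f) x n.

Definition ce (S : nat -> Prop) : Prop :=
  exists e : code, forall n, S n <-> exists v, eval (fun _ => false) e n v.

Definition Cantor := nat -> bool.

Fixpoint scode (s : list bool) : nat :=
  match s with
  | [] => 0
  | b :: s' => S (pair (if b then 1 else 0) (scode s'))
  end.

Definition prefix (s : list bool) (X : Cantor) : Prop :=
  forall k b, nth_error s k = Some b -> X k = b.

Definition cyl_sub (s : list bool) (A : Cantor -> Prop) : Prop :=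
  forall X, prefix s X -> A X.

Definition is_open (A : Cantor -> Prop) : Prop :=
  forall X, A X -> exists s, prefix s X /\ cyl_sub s A.

Definition unif_eff_open (U : nat -> Cantor -> Prop) : Prop :=
  (forall i, is_open (U i)) /\
  ce (fun n => exists i s, n = pair i (scode s) /\ cyl_sub s (U i)).

(** lambda(A) <= 2^-i for an open A: lambda(A) is the supremum over n of
    #{tau of length n : [tau] ⊆ A} / 2^n. *)
Definition measure_le_pow2 (A : Cantor -> Prop) (i : nat) : Prop :=
  forall (n : nat) (L : list (list bool)),
    NoDup L -> (forall t, In t L -> length t = n /\ cyl_sub t A) ->
    length L * 2 ^ i <= 2 ^ n.

Definition ML_test (V : nat -> Cantor -> Prop) : Prop :=
  unif_eff_open V /\ forall i, measure_le_pow2 (V i) i.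

Definition universal_ML_test (U : nat -> Cantor -> Prop) : Prop :=
  ML_test U /\
  forall V, ML_test V -> forall X, (forall i, V i X) -> forall i, U i X.

Definition MLR (X : Cantor) : Prop :=
  forall V, ML_test V -> ~ (forall i, V i X).

Definition rd (U : nat -> Cantor -> Prop) (X : Cantor) (i : nat) : Prop :=
  ~ U i X /\ forall j, j < i -> U j X.

Definition join (X Y : Cantor) : Cantor :=
  fun k => if Nat.even k then X (Nat.div2 k) else Y (Nat.div2 k).
Definition nat_code (n : nat) : Cantor := fun k => Nat.eqb k n.

Definition computes (e : code) (Y Z : Cantor) : Prop :=
  forall k, eval Y e k (if Z k then 1 else 0).

Definition exactly_layerwise_computable (U : nat -> Cantor -> Prop)
  (F : Cantor -> Cantor) : Prop :=
  exists e : code, forall X, MLR X -> forall i, rd U X i ->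
    computes e (join X (nat_code i)) (F X).

(* Main.v *)
(* Let [T] be a universal test built from an enumeration of all tests, and let
   [P] be the complement of [T 1]. Take [U = (G ∪ T 1, T 1, T 2, ...)] and
   [W = (2^ω, T 1, T 2, ...)], where [G] contains, for every string [s], the
   first extension of [s] of length [2 |s| + 2] whose cylinder is not covered by
   [T 1]; [G] is c.e. because a candidate only has to wait until all the
   candidates before it are covered. By measure some [X] is outside [G ∪ T 1],
   while by construction every neighbourhood of [X] meets [G \ T 1]. Hence
   [rd U] takes the value 0 at [X] and the value 1 at points of [P] arbitrarily
   close to [X]. All of [P] being the layer [rd W = 1], the function [rd U],
   which is trivially layerwise computable for [U], is discontinuous on a layer
   of [W] and so not layerwise computable for [W]. *)

Require Import Defs.
From Stdlib Require Import Arith List Lia Bool Cantor Classical ClassicalEpsilon.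
Import ListNotations.

(** * Computable functions and [Sigma_1] predicates *)

(** Clears the division by 2, so that the inverse of the library's bijection can serve as a pair of
    total projections. *)
Lemma pair_to_nat a b : pair a b = Cantor.to_nat (a, b).
Proof.
  pose proof (Cantor.to_nat_spec a b) as H.
  unfold pair.
  replace ((a + b) * (a + b + 1)) with ((Cantor.to_nat (a, b) - b) * 2) by nia.
  rewrite Nat.div_mul by lia. nia.
Qed.

Definition pi1 n := fst (Cantor.of_nat n).
Definition pi2 n := snd (Cantor.of_nat n).

Lemma pi1_pair a b : pi1 (pair a b) = a.
Proof. unfold pi1. now rewrite pair_to_nat, Cantor.cancel_of_to. Qed.

Lemma pi2_pair a b : pi2 (pair a b) = b.
Proof. unfold pi2. now rewrite pair_to_nat, Cantor.cancel_of_to. Qed.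

Lemma pair_pi n : pair (pi1 n) (pi2 n) = n.
Proof.
  unfold pi1, pi2. rewrite pair_to_nat, <- surjective_pairing.
  apply Cantor.cancel_to_of.
Qed.

Lemma pair_inj a b c d : pair a b = pair c d -> a = c /\ b = d.
Proof.
  intros H. split.
  - now rewrite <- (pi1_pair a b), H, pi1_pair.
  - now rewrite <- (pi2_pair a b), H, pi2_pair.
Qed.

Lemma pi2_0 : pi2 0 = 0.
Proof. reflexivity. Qed.

#[global] Opaque pair pi1 pi2.

(** Since [pair] is a function and not a constructor, inversion yields only equations between pairs;
    [pair_inj] resolves them here for all later inductions on recursion counters. *)
Lemma eval_prec_inv O f g a n v :
  eval O (Prec f g) (pair a n) v ->
  match n with
  | 0 => eval O f a v
  | S m => exists y, eval O (Prec f g) (pair a m) y /\ eval O g (pair a (pair m y)) v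
  end.
Proof.
  intros H. remember (pair a n) as x eqn:E.
  inversion H; subst;
    match goal with H : pair _ _ = pair _ _ |- _ => apply pair_inj in H end;
    intuition subst; eauto.
Qed.

(** The induction runs on the code, because the premise of [ev_mu] nests derivations under an
    existential. [Prec] takes an inner induction on the counter; for [Mu], the smaller of two
    distinct results would carry both a zero and a nonzero value. *)
Lemma eval_det O e : forall x v w, eval O e x v -> eval O e x w -> v = w.
Proof.
  induction e; intros x v w Hv Hw.
  - inversion Hv; inversion Hw; congruence.
  - inversion Hv; inversion Hw; congruence.
  - inversion Hv; inversion Hw; congruence.
  - inversion Hv; inversion Hw; subst.
    match goal with H : pair _ _ = pair _ _ |- _ =>
      apply pair_inj in H; intuition congruence end.
  - inversion Hv; inversion Hw; subst.
    match goal with H : pair _ _ = pair _ _ |- _ =>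
      apply pair_inj in H; intuition congruence end.
  - inversion Hv; inversion Hw; congruence.
  - inversion Hv; inversion Hw; subst. f_equal; eauto.
  - inversion Hv as [| | | | | | |f g x0 y z H1 H2| | |];
      inversion Hw as [| | | | | | |f' g' x0' y' z' H1' H2'| | |]; subst.
    rewrite (IHe2 _ _ _ H1 H1') in H2. eauto.
  - rewrite <- (pair_pi x) in Hv, Hw.
    revert v w Hv Hw. generalize (pi1 x) as a. generalize (pi2 x) as n.
    induction n as [|n IHn]; intros a v w Hv Hw;
      apply eval_prec_inv in Hv, Hw; [eauto|].
    destruct Hv as [y [H1 H2]], Hw as [y' [H1' H2']].
    rewrite (IHn _ _ _ H1 H1') in H2. eauto.
  - inversion Hv as [| | | | | | | | | |f a n H1 H2]; subst.
    inversion Hw as [| | | | | | | | | |f a n H1' H2']; subst.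
    destruct (Nat.lt_trichotomy v w) as [L|[L|L]]; auto.
    + destruct (H2' _ L) as [u [Hu Hu']]. elim Hu. eauto.
    + destruct (H2 _ L) as [u [Hu Hu']]. elim Hu. eauto.
Qed.

(** One code has to work under every oracle, so it can serve both in [ce], where the oracle is
    constantly false, and in layerwise computations. *)
Definition computable (f : nat -> nat) : Prop :=
  exists e, forall O x, eval O e x (f x).

Lemma computable_ext f g :
  computable f -> (forall x, g x = f x) -> computable g.
Proof. intros [e He] H. exists e. intros O x. rewrite H. apply He. Qed.

Lemma computable_id : computable (fun x => x).
Proof. exists Id. constructor. Qed.

Lemma computable_comp f g :
  computable f -> computable g -> computable (fun x => f (g x)).
Proof.
  intros [e He] [e' He']. exists (Comp e e').
  intros O x. econstructor; eauto.
Qed.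

Lemma computable_S f : computable f -> computable (fun x => S (f x)).
Proof.
  intros H. apply (computable_comp S f); auto. exists Succ. constructor.
Qed.

Lemma computable_const c : computable (fun _ => c).
Proof.
  induction c.
  - exists Zero. constructor.
  - now apply computable_S.
Qed.

Lemma computable_pi1 f : computable f -> computable (fun x => pi1 (f x)).
Proof.
  intros H. apply (computable_comp pi1 f); auto. exists Fst.
  intros O x. rewrite <- (pair_pi x) at 1. constructor.
Qed.

Lemma computable_pi2 f : computable f -> computable (fun x => pi2 (f x)).
Proof.
  intros H. apply (computable_comp pi2 f); auto. exists Snd.
  intros O x. rewrite <- (pair_pi x) at 1. constructor.
Qed.

Lemma computable_pair f g :
  computable f -> computable g -> computable (fun x => pair (f x) (g x)).
Proof.
  intros [e He] [e' He']. exists (Pair e e').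
  intros O x. constructor; auto.
Qed.

Lemma computable_rec a b g :
  computable a -> computable b ->
  computable (fun z => g (pi1 z) (pi1 (pi2 z)) (pi2 (pi2 z))) ->
  computable (fun x => nat_rect (fun _ => nat) (a x) (fun n y => g x n y) (b x)).
Proof.
  intros [ea Ha] [eb Hb] [eg Hg].
  exists (Comp (Prec ea eg) (Pair Id eb)). intros O x.
  apply ev_comp with (pair x (b x)).
  - constructor; [constructor | apply Hb].
  - generalize (b x). intros n; induction n; simpl.
    + constructor. apply Ha.
    + econstructor; [exact IHn|].
      specialize (Hg O (pair x (pair n (nat_rect (fun _ => nat) (a x)
        (fun n0 y => g x n0 y) n)))).
      now rewrite !pi2_pair, !pi1_pair in Hg.
Qed.

Definition computable_pred (b : nat -> bool) : Prop :=
  computable (fun x => Nat.b2n (b x)).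

Lemma computable_pred_comp b f :
  computable_pred b -> computable f -> computable_pred (fun x => b (f x)).
Proof. intros Hb Hf. apply (computable_comp _ _ Hb Hf). Qed.

Ltac cpt := repeat (cbv beta; first
  [ assumption | apply computable_const | apply computable_id
  | apply computable_S | apply computable_pi1 | apply computable_pi2
  | apply computable_pair
  | match goal with
    | H : computable ?f |- computable (fun x => ?f (@?g x)) =>
      apply (computable_comp f g H)
    | H : computable_pred ?b |- computable_pred (fun x => ?b (@?g x)) =>
      apply (computable_pred_comp b g H)
    end ]).

Lemma computable_add f g :
  computable f -> computable g -> computable (fun x => f x + g x).
Proof.
  intros Hf Hg.
  apply computable_ext with
    (fun x => nat_rect (fun _ => nat) (f x) (fun _ y => S y) (g x)).
  - apply (computable_rec f g (fun _ _ y => S y)); cpt.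
  - intros x. induction (g x); simpl; lia.
Qed.

Lemma computable_mul f g :
  computable f -> computable g -> computable (fun x => f x * g x).
Proof.
  intros Hf Hg.
  apply computable_ext with
    (fun x => nat_rect (fun _ => nat) 0 (fun _ y => y + f x) (g x)).
  - apply (computable_rec (fun _ => 0) g (fun x _ y => y + f x)); cpt.
    apply computable_add; cpt.
  - intros x. induction (g x); simpl; lia.
Qed.

Lemma computable_predecessor f : computable f -> computable (fun x => Nat.pred (f x)).
Proof.
  intros Hf.
  apply computable_ext with
    (fun x => nat_rect (fun _ => nat) 0 (fun n _ => n) (f x)).
  - apply (computable_rec (fun _ => 0) f (fun _ n _ => n)); cpt.
  - intros x. now destruct (f x).
Qed.

Lemma computable_sub f g :
  computable f -> computable g -> computable (fun x => f x - g x).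
Proof.
  intros Hf Hg.
  apply computable_ext with
    (fun x => nat_rect (fun _ => nat) (f x) (fun _ y => Nat.pred y) (g x)).
  - apply (computable_rec f g (fun _ _ y => Nat.pred y)); cpt.
    apply computable_predecessor; cpt.
  - intros x. induction (g x); simpl; lia.
Qed.

Lemma computable_pow2 f : computable f -> computable (fun x => 2 ^ f x).
Proof.
  intros Hf.
  apply computable_ext with
    (fun x => nat_rect (fun _ => nat) 1 (fun _ y => y + y) (f x)).
  - apply (computable_rec (fun _ => 1) f (fun _ _ y => y + y)); cpt.
    apply computable_add; cpt.
  - intros x. induction (f x) as [|n IH]; [reflexivity|].
    simpl nat_rect. rewrite <- IH, Nat.pow_succ_r'. lia.
Qed.

Lemma computable_if b f g :
  computable_pred b -> computable f -> computable g ->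
  computable (fun x => if b x then f x else g x).
Proof.
  intros Hb Hf Hg.
  apply computable_ext with
    (fun x => nat_rect (fun _ => nat) (g x) (fun _ _ => f x) (Nat.b2n (b x))).
  - apply (computable_rec g (fun x => Nat.b2n (b x)) (fun x _ _ => f x)); cpt.
  - intros x. now destruct (b x).
Qed.

Lemma computable_pred_ext b c :
  computable_pred b -> (forall x, c x = b x) -> computable_pred c.
Proof. intros H E. eapply computable_ext; [exact H|]. intros x. now rewrite E. Qed.

Lemma computable_pred_leb f g :
  computable f -> computable g -> computable_pred (fun x => f x <=? g x).
Proof.
  intros Hf Hg. unfold computable_pred.
  apply computable_ext with (fun x => 1 - (f x - g x)).
  - apply computable_sub; cpt. now apply computable_sub.
  - intros x. destruct (Nat.leb_spec (f x) (g x)); cbn [Nat.b2n]; lia.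
Qed.

Lemma computable_pred_and b c :
  computable_pred b -> computable_pred c -> computable_pred (fun x => b x && c x).
Proof.
  intros Hb Hc. unfold computable_pred.
  apply computable_ext with (fun x => Nat.b2n (b x) * Nat.b2n (c x)).
  - now apply computable_mul.
  - intros x. now destruct (b x), (c x).
Qed.

Lemma computable_pred_neg b :
  computable_pred b -> computable_pred (fun x => negb (b x)).
Proof.
  intros Hb. unfold computable_pred.
  apply computable_ext with (fun x => 1 - Nat.b2n (b x)).
  - apply computable_sub; cpt.
  - intros x. now destruct (b x).
Qed.

Lemma computable_pred_or b c :
  computable_pred b -> computable_pred c -> computable_pred (fun x => b x || c x).
Proof.
  intros Hb Hc.
  apply computable_pred_ext with (fun x => negb (negb (b x) && negb (c x))).
  - apply computable_pred_neg, computable_pred_and; now apply computable_pred_neg.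
  - intros x. now destruct (b x), (c x).
Qed.

Lemma computable_pred_eqb f g :
  computable f -> computable g -> computable_pred (fun x => f x =? g x).
Proof.
  intros Hf Hg.
  apply computable_pred_ext with (fun x => (f x <=? g x) && (g x <=? f x)).
  - apply computable_pred_and; now apply computable_pred_leb.
  - intros x. destruct (Nat.eqb_spec (f x) (g x)), (Nat.leb_spec (f x) (g x)),
      (Nat.leb_spec (g x) (f x)); simpl; lia.
Qed.

Fixpoint sum (f : nat -> nat) (n : nat) : nat :=
  match n with 0 => 0 | S n => sum f n + f n end.

Lemma computable_sum f h :
  computable (fun z => f (pi1 z) (pi2 z)) -> computable h ->
  computable (fun x => sum (f x) (h x)).
Proof.
  intros Hf Hh.
  apply computable_ext with
    (fun x => nat_rect (fun _ => nat) 0 (fun n y => y + f x n) (h x)).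
  - apply (computable_rec (fun _ => 0) h (fun x n y => y + f x n)); cpt.
    apply computable_add; cpt.
    apply computable_ext with (fun z => (fun u => f (pi1 u) (pi2 u))
      (pair (pi1 z) (pi1 (pi2 z)))).
    + apply (computable_comp _ _ Hf); cpt.
    + intros x. now rewrite pi1_pair, pi2_pair.
  - intros x. induction (h x); simpl; lia.
Qed.

Definition bex (p : nat -> bool) (n : nat) : bool := existsb p (seq 0 n).

Lemma bex_spec p n : bex p n = true <-> exists i, i < n /\ p i = true.
Proof.
  unfold bex. rewrite existsb_exists.
  split; intros [i [H1 H2]]; exists i; rewrite in_seq in *; split; auto; lia.
Qed.

Lemma computable_pred_bex p h :
  computable_pred (fun z => p (pi1 z) (pi2 z)) -> computable h ->
  computable_pred (fun x => bex (p x) (h x)).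
Proof.
  intros Hp Hh.
  apply computable_pred_ext with
    (fun x => 1 <=? sum (fun i => Nat.b2n (p x i)) (h x)).
  - apply computable_pred_leb; cpt.
    apply (computable_sum (fun x i => Nat.b2n (p x i))); auto.
  - intros x. apply eq_true_iff_eq. rewrite bex_spec, Nat.leb_le.
    induction (h x) as [|n IH]; simpl.
    + split; [intros [i Hi]|]; lia.
    + split.
      * intros [i [Hi Hp1]]. destruct (Nat.eq_dec i n) as [->|].
        -- rewrite Hp1. simpl. lia.
        -- enough (1 <= sum (fun i => Nat.b2n (p x i)) n) by lia.
           apply IH. exists i. split; auto. lia.
      * intros H. destruct (p x n) eqn:E.
        -- exists n. auto.
        -- simpl in H. rewrite Nat.add_0_r in H. apply IH in H.
           destruct H as [i [? ?]]. exists i. split; auto.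
Qed.

(** A normal form with one witness and a decidable matrix. Its closure properties replace the
    programming of enumerations; [ce_sigma1] returns to codes at the end. *)
Definition sigma1 (R : nat -> Prop) : Prop :=
  exists b, computable_pred b /\ forall x, R x <-> exists y, b (pair x y) = true.

Lemma sigma1_iff R Q : sigma1 R -> (forall x, Q x <-> R x) -> sigma1 Q.
Proof.
  intros [b [Hb H]] E. exists b. split; auto. intros x. now rewrite E.
Qed.

Lemma sigma1_subst R f : sigma1 R -> computable f -> sigma1 (fun x => R (f x)).
Proof.
  intros [b [Hb H]] Hf.
  exists (fun z => b (pair (f (pi1 z)) (pi2 z))). split.
  - cpt.
  - intros x. rewrite H. split; intros [y Hy]; exists y;
      rewrite pi1_pair, pi2_pair in Hy || rewrite pi1_pair, pi2_pair; exact Hy.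
Qed.

Lemma sigma1_pred b : computable_pred b -> sigma1 (fun x => b x = true).
Proof.
  intros Hb. exists (fun z => b (pi1 z)). split.
  - cpt.
  - intros x. split.
    + intros H. exists 0. now rewrite pi1_pair.
    + intros [y H]. now rewrite pi1_pair in H.
Qed.

Lemma sigma1_eq f g : computable f -> computable g -> sigma1 (fun x => f x = g x).
Proof.
  intros Hf Hg. apply sigma1_iff with (fun x => (f x =? g x) = true).
  - now apply sigma1_pred, computable_pred_eqb.
  - intros x. now rewrite Nat.eqb_eq.
Qed.

Lemma sigma1_le f g : computable f -> computable g -> sigma1 (fun x => f x <= g x).
Proof.
  intros Hf Hg. apply sigma1_iff with (fun x => (f x <=? g x) = true).
  - now apply sigma1_pred, computable_pred_leb.
  - intros x. now rewrite Nat.leb_le.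
Qed.

Lemma sigma1_ex R :
  sigma1 (fun z => R (pi1 z) (pi2 z)) -> sigma1 (fun x => exists y, R x y).
Proof.
  intros [b [Hb H]].
  exists (fun z => b (pair (pair (pi1 z) (pi1 (pi2 z))) (pi2 (pi2 z)))). split.
  - cpt.
  - intros x. split.
    + intros [y Hy]. specialize (H (pair x y)). rewrite pi1_pair, pi2_pair in H.
      apply H in Hy. destruct Hy as [w Hw]. exists (pair y w).
      now rewrite ?pi1_pair, ?pi2_pair, ?pi1_pair.
    + intros [y Hy]. exists (pi1 y). rewrite ?pi1_pair, ?pi2_pair in Hy.
      specialize (H (pair x (pi1 y))). rewrite pi1_pair, pi2_pair in H.
      apply H. now exists (pi2 y).
Qed.

Lemma sigma1_and R Q : sigma1 R -> sigma1 Q -> sigma1 (fun x => R x /\ Q x).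
Proof.
  intros [b [Hb HR]] [c [Hc HQ]].
  exists (fun z => b (pair (pi1 z) (pi1 (pi2 z))) && c (pair (pi1 z) (pi2 (pi2 z)))).
  split.
  - apply computable_pred_and; cpt.
  - intros x. rewrite HR, HQ. split.
    + intros [[y Hy] [w Hw]]. exists (pair y w).
      now rewrite !pi2_pair, !pi1_pair, Hy, Hw.
    + intros [y Hy]. rewrite !pi2_pair, !pi1_pair, andb_true_iff in Hy.
      destruct Hy; eauto.
Qed.

Lemma sigma1_or R Q : sigma1 R -> sigma1 Q -> sigma1 (fun x => R x \/ Q x).
Proof.
  intros [b [Hb HR]] [c [Hc HQ]].
  exists (fun z => b z || c z). split.
  - now apply computable_pred_or.
  - intros x. rewrite HR, HQ. split.
    + intros [[y Hy]|[y Hy]]; exists y; rewrite Hy; auto using orb_true_r.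
    + intros [y Hy]. rewrite orb_true_iff in Hy. destruct Hy; eauto.
Qed.

Lemma finite_bound (Q : nat -> nat -> Prop) n :
  (forall i, i < n -> exists y, Q i y) ->
  exists b, forall i, i < n -> exists y, y < b /\ Q i y.
Proof.
  induction n as [|n IH]; intros H.
  - exists 0. lia.
  - destruct IH as [b Hb]; [intros i Hi; apply H; lia|].
    destruct (H n) as [y Hy]; [lia|].
    exists (S (b + y)). intros i Hi. destruct (Nat.eq_dec i n) as [->|].
    + exists y. split; [lia|auto].
    + destruct (Hb i) as [w [? ?]]; [lia|]. exists w. split; [lia|auto].
Qed.

(** Finitely many witnesses have a common bound, and this bound becomes the single witness of the
    whole bounded quantifier. *)
Lemma sigma1_all R h :
  computable h -> sigma1 (fun z => R (pi1 z) (pi2 z)) ->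
  sigma1 (fun x => forall y, y < h x -> R x y).
Proof.
  intros Hh [b [Hb H]].
  assert (HR : forall x y, R x y <-> exists w, b (pair (pair x y) w) = true).
  { intros x y. specialize (H (pair x y)). now rewrite pi1_pair, pi2_pair in H. }
  (* With [z = pair x B], this says that [i] has no witness below [B]. *)
  set (c := fun z i => negb (bex (fun v => b (pair (pair (pi1 z) i) v)) (pi2 z))).
  exists (fun z => negb (bex (c z) (h (pi1 z)))). split.
  - apply computable_pred_neg.
    apply (computable_pred_bex c (fun z => h (pi1 z))).
    + apply computable_pred_neg.
      apply (computable_pred_bex
        (fun z v => b (pair (pair (pi1 (pi1 z)) (pi2 z)) v))); cpt.
    + cpt.
  - intros x.
    assert (E : forall B, negb (bex (c (pair x B)) (h x)) = true <->
      forall y, y < h x -> exists w, w < B /\ b (pair (pair x y) w) = true).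
    { intros B. rewrite negb_true_iff, <- not_true_iff_false, bex_spec.
      unfold c. rewrite pi1_pair, pi2_pair. split.
      - intros HN y Hy. apply NNPP. intros HC. apply HN. exists y.
        split; auto. rewrite negb_true_iff, <- not_true_iff_false, bex_spec. auto.
      - intros HA [y [Hy HC]].
        rewrite negb_true_iff, <- not_true_iff_false, bex_spec in HC. auto. }
    split.
    + intros HA. destruct (finite_bound (fun y w => b (pair (pair x y) w) = true)
        (h x)) as [B HB].
      { intros i Hi. now apply HR, HA. }
      exists B. rewrite pi1_pair. now apply E.
    + intros [B HB] y Hy. rewrite pi1_pair in HB. apply HR.
      destruct (proj1 (E B) HB y Hy) as [w [_ Hw]]. eauto.
Qed.

Lemma sigma1_imp_eq f g R :
  computable f -> computable g -> sigma1 R ->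
  sigma1 (fun x => f x = g x -> R x).
Proof.
  intros Hf Hg HR.
  apply sigma1_iff with (fun x => negb (f x =? g x) = true \/ R x).
  - apply sigma1_or; auto.
    now apply sigma1_pred, computable_pred_neg, computable_pred_eqb.
  - intros x. rewrite negb_true_iff, Nat.eqb_neq. tauto.
Qed.

(** Unbounded search for a witness. [Mu] looks for a zero, so it is applied to the negated matrix;
    determinism shows that any value it returns is a witness. *)
Lemma ce_sigma1 R : sigma1 R -> ce R.
Proof.
  intros [b [Hb H]].
  destruct (computable_pred_neg b Hb) as [e He].
  exists (Mu e). intros x. rewrite H. split.
  - intros [y Hy].
    destruct (dec_inh_nat_subset_has_unique_least_element
      (fun y => b (pair x y) = true)) as [n [[Hn Hmin] _]].
    { intros n. destruct (b (pair x n)); auto. }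
    { eauto. }
    exists n. constructor.
    + specialize (He (fun _ => false) (pair x n)). now rewrite Hn in He.
    + intros m Hm. exists 1. split; [lia|].
      specialize (He (fun _ => false) (pair x m)).
      destruct (b (pair x m)) eqn:E; auto.
      apply Hmin in E. lia.
  - intros [v Hv]. inversion Hv as [| | | | | | | | | |f x' n H0 _]; subst.
    exists v. apply NNPP. intros HN. apply not_true_is_false in HN.
    specialize (He (fun _ => false) (pair x v)). rewrite HN in He.
    discriminate (eval_det _ _ _ _ _ H0 He).
Qed.

Ltac cpt ::= repeat (cbv beta; first
  [ assumption | apply computable_const | apply computable_id
  | apply computable_S | apply computable_pi1 | apply computable_pi2
  | apply computable_pair | apply computable_add | apply computable_mul
  | apply computable_pow2
  | match goal with
    | H : computable ?f |- computable (fun x => ?f (@?g x)) =>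
      apply (computable_comp f g H)
    | H : computable_pred ?b |- computable_pred (fun x => ?b (@?g x)) =>
      apply (computable_pred_comp b g H)
    end ]).

Ltac sig := repeat (cbv beta; first
  [ assumption | apply sigma1_and | apply sigma1_or | apply sigma1_ex
  | apply sigma1_all | apply sigma1_eq | apply sigma1_le | apply sigma1_imp_eq
  | progress cpt ]).

(** * The graph of [eval] is [Sigma_1] *)

(** Iterated tail of a list coded by [lcode]. The code 0 of the empty list is a fixed point, by
    [pi2_0]. *)
Definition chop (d i : nat) : nat :=
  nat_rect (fun _ => nat) d (fun _ y => pi2 (Nat.pred y)) i.

Lemma computable_chop f g :
  computable f -> computable g -> computable (fun x => chop (f x) (g x)).
Proof.
  intros Hf Hg.
  apply (computable_rec f g (fun _ _ y => pi2 (Nat.pred y))); cpt.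
  apply computable_predecessor; cpt.
Qed.

Lemma chop_S d i : chop d (S i) = chop (pi2 (Nat.pred d)) i.
Proof. induction i; simpl in *; congruence. Qed.

Fixpoint lcode (l : list nat) : nat :=
  match l with [] => 0 | n :: l => S (pair n (lcode l)) end.

Lemma chop_lcode l i : chop (lcode l) i = lcode (skipn i l).
Proof.
  revert l; induction i as [|i IH]; intros l; [reflexivity|].
  rewrite chop_S. destruct l as [|n l]; simpl.
  - rewrite pi2_0. change 0 with (lcode []) at 1. now rewrite IH, skipn_nil.
  - now rewrite pi2_pair.
Qed.

Definition cmem (d n : nat) : Prop := exists i t, chop d i = S (pair n t).

Lemma cmem_lcode l n : In n l -> cmem (lcode l) n.
Proof.
  induction l as [|m l IH]; [easy|]. intros [->|H].
  - now exists 0, (lcode l).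
  - destruct (IH H) as [i [t Ht]]. exists (S i), t.
    rewrite chop_S. simpl. now rewrite pi2_pair.
Qed.

Lemma lcode_cmem l n : cmem (lcode l) n -> In n l.
Proof.
  intros [i [t Ht]]. rewrite chop_lcode in Ht.
  destruct (skipn i l) as [|m r] eqn:E; [discriminate|].
  simpl in Ht. injection Ht as Ht. apply pair_inj in Ht. destruct Ht as [-> _].
  rewrite <- (firstn_skipn i l), E. apply in_or_app. simpl. auto.
Qed.

Fixpoint enc (c : code) : nat :=
  match c with
  | Zero => pair 0 0
  | Succ => pair 1 0
  | Id => pair 2 0
  | Fst => pair 3 0
  | Snd => pair 4 0
  | Orc => pair 5 0
  | Pair f g => pair 6 (pair (enc f) (enc g))
  | Comp f g => pair 7 (pair (enc f) (enc g))
  | Prec f g => pair 8 (pair (enc f) (enc g))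
  | Mu f => pair 9 (enc f)
  end.

(** Gödel number of the assertion that program number [c] yields [v] on input [x]; [c] may be any
    number, even one outside the range of [enc]. *)
Definition judg (c x v : nat) : nat := pair c (pair x v).

(* [D] is the set of judgments already derived, for the constantly false oracle. *)
Definition step (D : nat -> Prop) (n : nat) : Prop :=
  (exists x, n = judg (pair 0 0) x 0) \/
  (exists x, n = judg (pair 1 0) x (S x)) \/
  (exists x, n = judg (pair 2 0) x x) \/
  (exists a b, n = judg (pair 3 0) (pair a b) a) \/
  (exists a b, n = judg (pair 4 0) (pair a b) b) \/
  (exists x, n = judg (pair 5 0) x 0) \/
  (exists f g x a b, n = judg (pair 6 (pair f g)) x (pair a b) /\
     D (judg f x a) /\ D (judg g x b)) \/
  (exists f g x y z, n = judg (pair 7 (pair f g)) x z /\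
     D (judg g x y) /\ D (judg f y z)) \/
  (exists f g x y, n = judg (pair 8 (pair f g)) (pair x 0) y /\ D (judg f x y)) \/
  (exists f g x m y z, n = judg (pair 8 (pair f g)) (pair x (S m)) z /\
     D (judg (pair 8 (pair f g)) (pair x m) y) /\
     D (judg g (pair x (pair m y)) z)) \/
  (exists f x k, n = judg (pair 9 f) x k /\ D (judg f (pair x k) 0) /\
     forall m, m < k -> exists v, D (judg f (pair x m) (S v))).

Lemma step_mono (D D' : nat -> Prop) n :
  (forall m, D m -> D' m) -> step D n -> step D' n.
Proof.
  intros H. unfold step.
  intuition (repeat match goal with H : exists _, _ |- _ => destruct H end);
    intuition eauto 12.
  do 10 right. do 3 eexists. split; [eassumption|]. split; [auto|].
  intros m Hm. destruct (H3 m Hm) as [v Hv]. eauto.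
Qed.

(** A derivation has its latest judgment at the head, justified by the tail alone. *)
Fixpoint valid (l : list nat) : Prop :=
  match l with [] => True | n :: l => step (fun m => In m l) n /\ valid l end.

Definition provable (n : nat) : Prop := exists l, valid l /\ In n l.

(** Arithmetizes derivations: [d] codes the list and [k] is its length. Only existential and bounded
    universal quantifiers remain, which makes provability $\Sigma_1$. *)
Lemma provable_iff n :
  provable n <->
  exists d k, chop d k = 0 /\ cmem d n /\ forall i, i < k ->
    exists m t, chop d i = S (pair m t) /\ step (cmem t) m.
Proof.
  split.
  - intros [l [Hl Hn]]. exists (lcode l), (length l). split; [|split].
    + now rewrite chop_lcode, skipn_all.
    + now apply cmem_lcode.
    + clear Hn. induction l as [|m l IH]; simpl; [lia|].
      destruct Hl as [Hm Hl]. intros [|i] Hi.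
      * exists m, (lcode l). split; [reflexivity|].
        revert Hm. apply step_mono. intros m'. apply cmem_lcode.
      * rewrite chop_S. simpl. rewrite pi2_pair. apply IH; auto. lia.
  - intros [d [k [H0 [Hn Hk]]]].
    enough (exists l, d = lcode l /\ valid l) as [l [-> Hl]].
    { exists l. split; auto. now apply lcode_cmem. }
    clear n Hn. revert d H0 Hk. induction k as [|k IH]; intros d H0 Hk.
    + exists []. simpl in *. auto.
    + destruct (Hk 0) as [m [t [E Hm]]]; [lia|]. simpl in E. subst d.
      rewrite chop_S in H0. simpl in H0. rewrite pi2_pair in H0.
      destruct (IH t H0) as [l [-> Hl]].
      * intros i Hi. destruct (Hk (S i)) as [m' [t' [E' H']]]; [lia|].
        rewrite chop_S in E'. simpl in E'. rewrite pi2_pair in E'. eauto.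
      * exists (m :: l). simpl. repeat split; auto.
        revert Hm. apply step_mono. intros m'. apply lcode_cmem.
Qed.

Lemma sigma1_provable : sigma1 provable.
Proof.
  eapply sigma1_iff; [|apply provable_iff].
  unfold step, cmem, judg. sig; apply computable_chop; cpt.
Qed.

Lemma valid_app l r : valid l -> valid r -> valid (l ++ r).
Proof.
  induction l as [|n l IH]; simpl; auto.
  intros [Hn Hl] Hr. split; auto.
  revert Hn. apply step_mono. intros m Hm. apply in_or_app. auto.
Qed.

(** The premises come with separate derivations, which are concatenated into one. *)
Lemma provable_step n : step provable n -> provable n.
Proof.
  intros H.
  enough (exists l, valid l /\ step (fun m => In m l) n) as [l [Hl Hn]].
  { exists (n :: l). simpl. auto. }
  unfold step in H.
  repeat (destruct H as [H|H]);
    repeat match goal with H : exists _, _ |- _ => destruct H end.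
  1-6: exists []; split; [exact I|]; unfold step; eauto 12.
  1,2,4: destruct H as [? [[l [? ?]] [r [? ?]]]]; exists (l ++ r);
    (split; [now apply valid_app|]); unfold step.
  - do 6 right. left. do 5 eexists. split; [eassumption|].
    split; apply in_or_app; eauto.
  - do 7 right. left. do 5 eexists. split; [eassumption|].
    split; apply in_or_app; eauto.
  - do 9 right. left. do 6 eexists. split; [eassumption|].
    split; apply in_or_app; eauto.
  - destruct H as [? [l [? ?]]]. exists l. split; auto.
    do 8 right. left. eauto 7.
  - destruct H as [? [[l [? ?]] Hm]].
    (* For the search rule, the derivations of the nonzero values are merged one argument at a
       time. *)
    assert (forall j, j <= x1 -> exists r, valid r /\ forall m, m < j ->
      exists v, In (judg x (pair x0 m) (S v)) r) as HA.
    { induction j as [|j IH]; intros Hj.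
      - exists []. split; [exact I|lia].
      - destruct IH as [r [Hr HI]]; [lia|].
        destruct (Hm j) as [v [r' [Hr' Hv]]]; [lia|].
        exists (r' ++ r). split; [now apply valid_app|].
        intros m Hmj. destruct (Nat.eq_dec m j) as [->|].
        + exists v. apply in_or_app. auto.
        + destruct (HI m) as [w Hw]; [lia|]. exists w. apply in_or_app. auto. }
    destruct (HA x1 (le_n _)) as [r [Hr HI]].
    exists (l ++ r). split; [now apply valid_app|].
    do 10 right. exists x, x0, x1. split; auto. split; [auto using in_or_app|].
    intros m Hlt. destruct (HI m Hlt) as [v Hv]. exists v. auto using in_or_app.
Qed.

Lemma eval_provable c x v :
  eval (fun _ => false) c x v -> provable (judg (enc c) x v).
Proof.
  revert x v. induction c; intros x v H; apply provable_step; unfold step.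
  1-6: inversion H; subst; simpl.
  1: left; eauto.
  1: do 1 right; left; eauto.
  1: do 2 right; left; eauto.
  1: do 3 right; left; eauto.
  1: do 4 right; left; eauto.
  1: do 5 right; left; eauto.
  - inversion H; subst. do 6 right. left. do 5 eexists. split; [reflexivity|auto].
  - inversion H; subst. do 7 right. left. do 5 eexists. split; [reflexivity|eauto].
  - rewrite <- (pair_pi x) in *. revert v H.
    generalize (pi1 x) as a. generalize (pi2 x) as n.
    induction n as [|n IHn]; intros a v H; apply eval_prec_inv in H.
    + do 8 right. left. do 4 eexists. split; [reflexivity|auto].
    + destruct H as [y [H1 H2]]. do 9 right. left. do 6 eexists.
      split; [reflexivity|]. split; [exact (provable_step _ (IHn _ _ H1))|auto].
  - inversion H as [| | | | | | | | | |f y n H0 Hlt]; subst.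
    do 10 right. exists (enc c), x, v.
    split; [auto|]. split; [auto|].
    intros m Hm. destruct (Hlt m Hm) as [[|w] [Hw Hw']]; [easy|]. eauto.
Qed.

Lemma step_sound (D : nat -> Prop) n :
  (forall m, D m -> forall c x v, m = judg (enc c) x v ->
     eval (fun _ => false) c x v) ->
  step D n -> forall c x v, n = judg (enc c) x v -> eval (fun _ => false) c x v.
Proof.
  intros HD H c x v E. unfold step in H.
  repeat (destruct H as [H|H]);
    repeat match goal with H : exists _, _ |- _ => destruct H
    | H : _ /\ _ |- _ => destruct H end; subst n;
    match goal with H : judg _ _ _ = _ |- _ => unfold judg in H;
      apply pair_inj in H; destruct H as [Ec Exv]; apply pair_inj in Exv;
      destruct Exv as [Ex Ev]; subst x v end;
    (* Comparing tags leaves only the constructor that matches the rule applied. *)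
    destruct c; simpl in Ec; apply pair_inj in Ec; destruct Ec as [Et Ec];
    try discriminate Et;
    try (apply pair_inj in Ec; destruct Ec as [Ef Eg]); subst.
  all: try (econstructor; solve [eauto]).
  constructor; [eapply HD; eauto|].
  intros m Hm. destruct (H1 m Hm) as [w Hw]. exists (S w). split; [easy|].
  eapply HD; eauto.
Qed.

Lemma provable_sound n :
  provable n -> forall c x v, n = judg (enc c) x v -> eval (fun _ => false) c x v.
Proof.
  intros [l [Hl Hn]]. revert n Hn.
  induction l as [|m l IH]; [easy|]. destruct Hl as [Hm Hl].
  intros n [<-|Hn]; [|now apply IH].
  exact (step_sound _ _ (IH Hl) Hm).
Qed.

(** The argument [t] is a witness in the $\Sigma_1$ form of halting, not a running time, and nothing
    makes [H] monotone in it; hence the search over all [w <= t] in [hits]. *)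
Lemma universal_halting :
  exists H : nat -> nat -> nat -> bool,
    computable_pred (fun z => H (pi1 z) (pi1 (pi2 z)) (pi2 (pi2 z))) /\
    forall e : code, exists c, forall n,
      (exists v, eval (fun _ => false) e n v) <-> exists t, H c n t = true.
Proof.
  assert (S1 : sigma1 (fun z => exists v, provable (judg (pi1 z) (pi2 z) v))).
  { apply sigma1_ex. apply sigma1_subst; [apply sigma1_provable|]. unfold judg. cpt. }
  destruct S1 as [b [Hb E]].
  exists (fun c n t => b (pair (pair c n) t)). split; [cpt|].
  intros e. exists (enc e). intros n. rewrite <- E, pi1_pair, pi2_pair.
  split; intros [v Hv]; exists v.
  - now apply eval_provable.
  - now apply (provable_sound _ Hv).
Qed.

(** * Cylinders and counting *)

(* The string [X 0, ..., X (n-1)] is identified with the number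
   [num X n < 2^n] having it as binary expansion, least significant bit first;
   restriction of strings is then reduction modulo a power of two. *)
Fixpoint num (X : Cantor) (n : nat) : nat :=
  match n with
  | 0 => 0
  | S n => num X n + 2 ^ n * Nat.b2n (X n)
  end.

Lemma pow2_pos n : 2 ^ n <> 0.
Proof. apply Nat.pow_nonzero. lia. Qed.

Lemma num_lt X n : num X n < 2 ^ n.
Proof.
  induction n; simpl; [lia|]. destruct (X n); simpl; lia.
Qed.

Lemma mod_mod_pow2 j m n : m <= n -> (j mod 2 ^ n) mod 2 ^ m = j mod 2 ^ m.
Proof.
  intros H. replace n with (m + (n - m)) by lia. rewrite Nat.pow_add_r.
  rewrite Nat.Div0.mod_mul_r, Nat.mul_comm, Nat.Div0.mod_add.
  apply Nat.Div0.mod_mod.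
Qed.

Lemma num_mod X m n : m <= n -> num X n mod 2 ^ m = num X m.
Proof.
  induction 1 as [|n H IH].
  - apply Nat.mod_small, num_lt.
  - rewrite <- IH. simpl num.
    replace n with (m + (n - m)) at 2 by lia. rewrite Nat.pow_add_r.
    rewrite <- Nat.mul_assoc, Nat.mul_comm, (Nat.mul_comm _ (2 ^ m)).
    rewrite (Nat.mul_comm (2 ^ m)). apply Nat.Div0.mod_add.
Qed.

Lemma num_testbit j n : num (Nat.testbit j) n = j mod 2 ^ n.
Proof.
  induction n as [|n IH]; [now rewrite Nat.mod_1_r|].
  simpl num. rewrite IH, Nat.testbit_spec', Nat.pow_succ_r', Nat.mul_comm.
  rewrite (Nat.mul_comm 2). now rewrite Nat.Div0.mod_mul_r, (Nat.mul_comm _ (2 ^ n)).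
Qed.

Lemma num_ext X Y n : (forall k, k < n -> X k = Y k) -> num X n = num Y n.
Proof.
  induction n as [|n IH]; intros H; simpl; [auto|].
  rewrite H by lia. rewrite IH; auto.
Qed.

Lemma num_inj X Y n : num X n = num Y n -> forall k, k < n -> X k = Y k.
Proof.
  induction n as [|n IH]; intros H k Hk; [lia|].
  assert (E : num X n = num Y n).
  { rewrite <- (num_mod X n (S n)), <- (num_mod Y n (S n)) by lia. now rewrite H. }
  simpl in H. rewrite E in H.
  destruct (Nat.eq_dec k n) as [->|]; [|apply IH; auto; lia].
  pose proof (pow2_pos n). destruct (X n), (Y n); simpl in H; auto; lia.
Qed.

(** Numerical counterpart of [cyl_sub]. For [j >= 2 ^ n] it holds vacuously, which explains the side
    conditions [j < 2 ^ n] below. *)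
Definition cyl (A : Cantor -> Prop) (n j : nat) : Prop :=
  forall X, num X n = j -> A X.

Lemma cyl_ext_mod A n N j : n <= N -> cyl A n (j mod 2 ^ n) -> cyl A N j.
Proof. intros H HA X <-. apply HA. symmetry. now apply num_mod. Qed.

Definition bits (n j : nat) : list bool := map (Nat.testbit j) (seq 0 n).

Definition lnum (s : list bool) : nat := num (fun k => nth k s false) (length s).

Lemma bits_lnum s : bits (length s) (lnum s) = s.
Proof.
  apply nth_ext with false false.
  - unfold bits. now rewrite length_map, length_seq.
  - unfold bits. rewrite length_map, length_seq. intros k Hk.
    rewrite nth_indep with (d' := Nat.testbit (lnum s) 0)
      by now rewrite length_map, length_seq.
    rewrite map_nth, seq_nth by auto. simpl.
    apply (num_inj _ (fun k => nth k s false) (length s)); auto.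
    rewrite num_testbit. apply Nat.mod_small, num_lt.
Qed.

Lemma length_bits n j : length (bits n j) = n.
Proof. unfold bits. now rewrite length_map, length_seq. Qed.

Lemma prefix_num s X : prefix s X <-> num X (length s) = lnum s.
Proof.
  split.
  - intros H. apply num_ext. intros k Hk. apply H. now apply nth_error_nth'.
  - intros H k b Hb. rewrite (num_inj _ _ _ H).
    + now apply nth_error_nth.
    + apply nth_error_Some. congruence.
Qed.

Lemma cyl_sub_lnum s A : cyl_sub s A <-> cyl A (length s) (lnum s).
Proof.
  unfold cyl_sub, cyl. split; intros H X HX; apply H; now apply prefix_num.
Qed.

Lemma lnum_bits n j : j < 2 ^ n -> lnum (bits n j) = j.
Proof.
  intros H. unfold lnum. rewrite length_bits.
  transitivity (num (Nat.testbit j) n); [|now rewrite num_testbit, Nat.mod_small].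
  apply num_ext. intros k Hk. unfold bits.
  rewrite nth_indep with (d' := Nat.testbit j 0)
    by now rewrite length_map, length_seq.
  now rewrite map_nth, seq_nth by auto.
Qed.

Lemma cyl_sub_bits n j A : j < 2 ^ n -> cyl_sub (bits n j) A <-> cyl A n j.
Proof. intros H. now rewrite cyl_sub_lnum, length_bits, lnum_bits. Qed.

(** Classical truth value; it serves for counting and for defining functions on Cantor space, with
    no claim of computability. *)
Definition dec (P : Prop) : bool :=
  if excluded_middle_informative P then true else false.

Lemma dec_true P : dec P = true <-> P.
Proof. unfold dec. destruct excluded_middle_informative; split; easy. Qed.

(** Greedy descent: the next bit is 0 if that child is bad and 1 otherwise, and [g] records the node
    reached. *)
Lemma koenig (bad : nat -> nat -> Prop) :
  bad 0 0 ->
  (forall n j, bad n j -> bad (S n) j \/ bad (S n) (j + 2 ^ n)) ->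
  exists X, forall n, bad n (num X n).
Proof.
  intros H0 HS.
  set (g := nat_rect (fun _ => nat) 0
    (fun n j => j + 2 ^ n * Nat.b2n (negb (dec (bad (S n) j))))).
  exists (fun n => negb (dec (bad (S n) (g n)))).
  set (X := fun n => _).
  assert (E : forall n, num X n = g n).
  { induction n as [|n IH]; simpl; auto. }
  induction n as [|n IH]; auto.
  simpl. rewrite E in *. unfold X.
  destruct (dec (bad (S n) (g n))) eqn:D; simpl.
  - rewrite Nat.mul_0_r, Nat.add_0_r. now apply dec_true.
  - rewrite Nat.mul_1_r. destruct (HS _ _ IH) as [H|H]; auto.
    apply <- dec_true in H. congruence.
Qed.

Definition covered (E : nat -> nat -> Prop) (N J : nat) : Prop :=
  exists n, n <= N /\ E n (J mod 2 ^ n).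

Lemma covered_mono E N N' J :
  N <= N' -> covered E N (J mod 2 ^ N) -> covered E N' J.
Proof.
  intros H [n [Hn HE]]. exists n. split; [lia|].
  now rewrite mod_mod_pow2 in HE.
Qed.

(** A node is good if one level covers all its extensions. Two good children make a good parent, so
    a bad root would start a path of bad nodes; but the path meets [E], and the node where it does
    is good. *)
Lemma compactness E :
  (forall X, exists n, E n (num X n)) ->
  exists N, forall J, J < 2 ^ N -> covered E N J.
Proof.
  intros H.
  set (good := fun n j => exists N, n <= N /\
    forall J, J < 2 ^ N -> J mod 2 ^ n = j -> covered E N J).
  enough (good 0 0) as [N [_ HN]].
  { exists N. intros J HJ. apply HN; auto. }
  apply NNPP. intros H0.
  destruct (koenig (fun n j => ~ good n j)) as [X HX]; auto.
  - intros n j HB. apply NNPP. intros HC. apply not_or_and in HC.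
    destruct HC as [HC1 HC2]. apply NNPP in HC1, HC2.
    destruct HC1 as [N1 [L1 C1]], HC2 as [N2 [L2 C2]].
    apply HB. exists (N1 + N2). split; [lia|].
    intros J HJ Hj.
    assert (ES : J mod 2 ^ S n = j \/ J mod 2 ^ S n = j + 2 ^ n).
    { rewrite <- !num_testbit in *. simpl num. rewrite Hj.
      destruct (Nat.testbit J n); simpl; lia. }
    destruct ES as [ES|ES].
    + apply covered_mono with N1; [lia|]. apply C1.
      * apply Nat.mod_upper_bound, pow2_pos.
      * now rewrite mod_mod_pow2.
    + apply covered_mono with N2; [lia|]. apply C2.
      * apply Nat.mod_upper_bound, pow2_pos.
      * now rewrite mod_mod_pow2.
  - destruct (H X) as [n Hn]. apply (HX n). exists n. split; auto.
    intros J HJ EJ. exists n. split; auto. now rewrite EJ.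
Qed.

Definition opn (E : nat -> nat -> Prop) : Cantor -> Prop :=
  fun X => exists n, E n (num X n).

(** Finite form of the inclusion of a cylinder in [opn E]. Unlike [cyl] it does not quantify over
    sequences, and it is $\Sigma_1$ when [E] is. *)
Definition fcyl (E : nat -> nat -> Prop) (n j : nat) : Prop :=
  exists N, n <= N /\ forall J, J < 2 ^ N -> J mod 2 ^ n = j -> covered E N J.

Lemma cyl_opn E n j : j < 2 ^ n -> cyl (opn E) n j <-> fcyl E n j.
Proof.
  intros Hj. split.
  - intros H.
    (* The strings that differ from [j] on the first [n] bits are added, so that the whole space is
       covered. *)
    destruct (compactness (fun m i => E m i \/ n <= m /\ i mod 2 ^ n <> j))
      as [N HN].
    + intros X. destruct (Nat.eq_dec (num X n) j) as [HX|HX].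
      * destruct (H X HX) as [m Hm]. eauto.
      * exists n. right. split; auto. rewrite Nat.mod_small; auto. apply num_lt.
    + exists (N + n). split; [lia|]. intros J HJ EJ.
      destruct (HN (J mod 2 ^ N)) as [m [Hm [HE|[Hn HE]]]].
      * apply Nat.mod_upper_bound, pow2_pos.
      * exists m. split; [lia|]. now rewrite mod_mod_pow2 in HE.
      * now rewrite !mod_mod_pow2 in HE by lia.
  - intros [N [L HN]] X HX.
    destruct (HN (num X N)) as [m [Hm HE]].
    + apply num_lt.
    + now rewrite num_mod.
    + exists m. now rewrite num_mod in HE.
Qed.

(** * Counting strings of a given length *)

Fixpoint count (P : nat -> Prop) (N : nat) : nat :=
  match N with
  | 0 => 0
  | S n => count P n + Nat.b2n (dec (P n))
  end.

Lemma count_list P N :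
  exists L, NoDup L /\ length L = count P N /\ forall j, In j L <-> j < N /\ P j.
Proof.
  induction N as [|N [L [H1 [H2 H3]]]].
  - exists []. split; [constructor|]. split; auto. intros j. simpl. lia.
  - simpl. destruct (dec (P N)) eqn:D.
    + apply -> dec_true in D. exists (N :: L). split; [|split].
      * constructor; auto. rewrite H3. lia.
      * simpl. lia.
      * intros j. simpl. rewrite H3. split.
        -- intros [<-|[H HP]]; split; auto.
        -- intros [Hj HP]. destruct (Nat.eq_dec N j); auto.
           right. split; auto. lia.
    + exists L. split; [auto|]. split; [simpl; lia|].
      intros j. rewrite H3. split; intros [Hj HP]; split; auto.
      enough (j <> N) by lia. intros ->. apply <- dec_true in HP. congruence.
Qed.

Lemma length_le_count P N L :
  NoDup L -> (forall j, In j L -> j < N /\ P j) -> length L <= count P N.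
Proof.
  intros HL H. destruct (count_list P N) as [L' [_ [<- HL']]].
  apply NoDup_incl_length; auto. intros j Hj. now apply HL', H.
Qed.

Lemma count_mono (P Q : nat -> Prop) N :
  (forall j, j < N -> P j -> Q j) -> count P N <= count Q N.
Proof.
  intros H. destruct (count_list P N) as [L [H1 [<- H3]]].
  apply length_le_count; auto. intros j Hj. apply H3 in Hj.
  destruct Hj. auto.
Qed.

Lemma count_ext (P Q : nat -> Prop) N :
  (forall j, j < N -> P j <-> Q j) -> count P N = count Q N.
Proof.
  intros H. apply Nat.le_antisymm; apply count_mono; intros j Hj; now apply H.
Qed.

Lemma count_or (P Q : nat -> Prop) N :
  count (fun j => P j \/ Q j) N <= count P N + count Q N.
Proof.
  induction N as [|N IH]; simpl; auto.
  destruct (dec (P N \/ Q N)) eqn:D; simpl; [|lia].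
  apply -> dec_true in D.
  destruct D as [D|D]; apply <- dec_true in D; rewrite D; simpl; lia.
Qed.

Lemma count_all (P : nat -> Prop) N : (forall j, j < N -> P j) -> count P N = N.
Proof.
  induction N as [|N IH]; intros H; simpl; auto.
  rewrite IH by auto. rewrite (proj2 (dec_true _) (H N (Nat.lt_succ_diag_r N))).
  simpl. lia.
Qed.

Lemma count_none (P : nat -> Prop) N : (forall j, j < N -> ~ P j) -> count P N = 0.
Proof.
  induction N as [|N IH]; intros H; simpl; auto.
  rewrite IH by auto. destruct (dec (P N)) eqn:D; auto.
  apply -> dec_true in D. elim (H N); auto.
Qed.

Lemma count_add P m n :
  count P (m + n) = count P m + count (fun j => P (m + j)) n.
Proof.
  induction n as [|n IH]; simpl; [now rewrite !Nat.add_0_r|].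
  rewrite Nat.add_succ_r. simpl. rewrite IH. lia.
Qed.

Lemma count_mod P a b : a <> 0 -> count (fun j => P (j mod a)) (a * b) = b * count P a.
Proof.
  intros Ha. induction b as [|b IH]; [now rewrite Nat.mul_0_r|].
  rewrite Nat.mul_succ_r, count_add, IH. simpl. rewrite Nat.add_comm. f_equal.
  apply count_ext. intros j Hj.
  rewrite Nat.add_comm, Nat.mul_comm, Nat.Div0.mod_add, Nat.mod_small; tauto.
Qed.

(** Each string of length [n] has $2^{N-n}$ extensions of length [N]. *)
Lemma count_mod_pow2 P n N :
  n <= N -> count (fun j => P (j mod 2 ^ n)) (2 ^ N) = 2 ^ (N - n) * count P (2 ^ n).
Proof.
  intros H. rewrite <- count_mod by apply pow2_pos.
  rewrite <- Nat.pow_add_r. do 2 f_equal. lia.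
Qed.

Lemma count_inj P (f : nat -> nat) N M :
  (forall j, j < N -> P j -> f j < M) ->
  (forall i j, i < N -> j < N -> P i -> P j -> f i = f j -> i = j) ->
  count P N <= M.
Proof.
  intros H1 H2. destruct (count_list P N) as [L [HN [<- HL]]].
  rewrite <- (length_map f), <- (length_seq M 0).
  apply NoDup_incl_length.
  - apply NoDup_map_NoDup_ForallPairs; auto.
    intros i j Hi Hj. apply HL in Hi, Hj. destruct Hi, Hj. auto.
  - intros k Hk. apply in_map_iff in Hk. destruct Hk as [j [<- Hj]].
    apply HL in Hj. destruct Hj. apply in_seq. split; [lia|]. apply H1; auto.
Qed.

(* The geometric series [sum_{e < M} 2^-(i+e+1) = 2^-i (1 - 2^-M)]. *)
Lemma count_geometric (P : nat -> nat -> Prop) i M N :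
  (forall e, e < M -> count (P e) N * 2 ^ (i + e + 1) <= N) ->
  count (fun j => exists e, e < M /\ P e j) N * 2 ^ i * 2 ^ M + N <= N * 2 ^ M.
Proof.
  induction M as [|M IH]; intros H.
  - rewrite count_none; [simpl; lia|]. intros j _ [e [He _]]. lia.
  - assert (L : count (fun j => exists e, e < S M /\ P e j) N <=
      count (fun j => exists e, e < M /\ P e j) N + count (P M) N).
    { rewrite <- count_or. apply count_mono. intros j _ [e [He HP]].
      destruct (Nat.eq_dec e M) as [->|]; auto. left. exists e. split; auto. lia. }
    specialize (IH (fun e He => H e (Nat.lt_lt_succ_r _ _ He))).
    specialize (H M (Nat.lt_succ_diag_r M)).
    rewrite !Nat.pow_add_r, Nat.pow_1_r in H. rewrite Nat.pow_succ_r'.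
    set (a := count _ N) in L |- *. set (b := count _ N) in L, IH.
    set (c := count _ N) in L, H.
    pose proof (pow2_pos i). pose proof (pow2_pos M).
    assert (a * 2 ^ i * 2 ^ M <= (b + c) * 2 ^ i * 2 ^ M).
    { do 2 apply Nat.mul_le_mono_r. auto. }
    lia.
Qed.

(** [bits n] and [lnum] are mutually inverse between numbers below [2 ^ n] and strings of length
    [n], so they carry duplicate-free lists to duplicate-free lists. *)
Lemma measure_le_count A i :
  measure_le_pow2 A i <-> forall n, count (cyl A n) (2 ^ n) * 2 ^ i <= 2 ^ n.
Proof.
  split.
  - intros H n. destruct (count_list (cyl A n) (2 ^ n)) as [L [HN [<- HL]]].
    rewrite <- (length_map (bits n)). apply H.
    + apply NoDup_map_NoDup_ForallPairs; auto.
      intros j k Hj Hk E. apply HL in Hj, Hk.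
      rewrite <- (lnum_bits n j), E, lnum_bits; tauto.
    + intros t Ht. apply in_map_iff in Ht. destruct Ht as [j [<- Hj]].
      apply HL in Hj. rewrite length_bits, cyl_sub_bits; tauto.
  - intros H n L HN HL. specialize (H n).
    enough (length L <= count (cyl A n) (2 ^ n)) by nia.
    rewrite <- (length_map lnum). apply length_le_count.
    + apply NoDup_map_NoDup_ForallPairs; auto.
      intros s t Hs Ht E. apply HL in Hs, Ht.
      rewrite <- (bits_lnum s), <- (bits_lnum t), E. f_equal. lia.
    + intros j Hj. apply in_map_iff in Hj. destruct Hj as [s [<- Hs]].
      destruct (HL s Hs) as [E Hc]. apply cyl_sub_lnum in Hc. subst n.
      split; auto. apply num_lt.
Qed.

(** * Effective openness *)

Lemma computable_mod_pow2 f g :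
  computable f -> computable g -> computable (fun x => f x mod 2 ^ g x).
Proof.
  intros Hf Hg.
  (* Counts up to [f x], returning to 0 whenever the modulus is reached. *)
  apply computable_ext with (fun x => nat_rect (fun _ => nat) 0
    (fun _ y => if S y =? 2 ^ g x then 0 else S y) (f x)).
  - apply (computable_rec (fun _ => 0) f
      (fun x _ y => if S y =? 2 ^ g x then 0 else S y)); cpt.
    apply computable_if; cpt. apply computable_pred_eqb; cpt.
  - intros x. pose proof (pow2_pos (g x)) as Hb. set (b := 2 ^ g x) in *.
    clearbody b. induction (f x) as [|n IH]; cbn [nat_rect].
    + now apply Nat.mod_small; lia.
    + rewrite <- IH.
      pose proof (Nat.mod_upper_bound n b Hb).
      pose proof (Nat.div_mod_eq n b).
      destruct (Nat.eqb_spec (S (n mod b)) b); symmetry.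
      * apply Nat.mod_unique with (S (n / b)); lia.
      * apply Nat.mod_unique with (n / b); lia.
Qed.

Lemma computable_pred_testbit f g :
  computable f -> computable g -> computable_pred (fun x => Nat.testbit (f x) (g x)).
Proof.
  intros Hf Hg.
  apply computable_pred_ext with (fun x => 2 ^ g x <=? f x mod 2 ^ S (g x)).
  - apply computable_pred_leb; cpt. apply computable_mod_pow2; cpt.
  - intros x. rewrite <- num_testbit. simpl num.
    pose proof (num_lt (Nat.testbit (f x)) (g x)).
    destruct (Nat.testbit (f x) (g x)); simpl Nat.b2n; symmetry.
    + apply Nat.leb_le. lia.
    + apply Nat.leb_gt. lia.
Qed.

(** The code is built from the last bit to the first: after [m] rounds it is that of the suffix of
    length [m]. *)
Lemma computable_scode_bits f g :
  computable f -> computable g -> computable (fun x => scode (bits (f x) (g x))).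
Proof.
  intros Hf Hg.
  apply computable_ext with (fun x => nat_rect (fun _ => nat) 0
    (fun m y => S (pair (Nat.b2n (Nat.testbit (g x) (f x - S m))) y)) (f x)).
  - apply (computable_rec (fun _ => 0) f
      (fun x m y => S (pair (Nat.b2n (Nat.testbit (g x) (f x - S m))) y))); cpt.
    apply (computable_pred_testbit (fun z => g (pi1 z))
      (fun z => f (pi1 z) - S (pi1 (pi2 z)))); cpt.
    apply computable_sub; cpt.
  - intros x. unfold bits.
    enough (forall m, m <= f x -> scode (map (Nat.testbit (g x)) (seq (f x - m) m)) =
      nat_rect (fun _ => nat) 0
        (fun m y => S (pair (Nat.b2n (Nat.testbit (g x) (f x - S m))) y)) m) as H.
    { rewrite <- H by auto. now rewrite Nat.sub_diag. }
    induction m as [|m IH]; intros Hm; [reflexivity|].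
    simpl nat_rect. rewrite <- IH by lia. simpl.
    now replace (S (f x - S m)) with (f x - m) by lia.
Qed.

Definition sigma1_3 (E : nat -> nat -> nat -> Prop) : Prop :=
  sigma1 (fun z => E (pi1 z) (pi1 (pi2 z)) (pi2 (pi2 z))).

Lemma sigma1_subst3 E f g h :
  sigma1_3 E -> computable f -> computable g -> computable h ->
  sigma1 (fun x => E (f x) (g x) (h x)).
Proof.
  intros HE Hf Hg Hh.
  apply sigma1_iff with (fun x => (fun z => E (pi1 z) (pi1 (pi2 z)) (pi2 (pi2 z)))
    (pair (f x) (pair (g x) (h x)))).
  - apply (sigma1_subst _ _ HE). cpt.
  - intros x. now rewrite pi2_pair, !pi1_pair, pi2_pair.
Qed.

Lemma sigma1_fcyl E f g h :
  sigma1_3 E -> computable f -> computable g -> computable h ->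
  sigma1 (fun x => fcyl (E (f x)) (g x) (h x)).
Proof.
  intros HE Hf Hg Hh. unfold fcyl, covered.
  sig; try (apply computable_mod_pow2; cpt).
  apply (sigma1_subst3 E); cpt. apply computable_mod_pow2; cpt.
Qed.

(** Compactness is the point: by [cyl_opn], inclusion of a cylinder in the generated set becomes the
    $\Sigma_1$ condition [fcyl]. *)
Lemma unif_eff_open_opn E : sigma1_3 E -> unif_eff_open (fun i => opn (E i)).
Proof.
  intros HE. split.
  - intros i X [n Hn]. exists (bits n (num X n)). split.
    + apply prefix_num. rewrite length_bits, lnum_bits; auto. apply num_lt.
    + apply cyl_sub_bits; [apply num_lt|].
      intros Y HY. exists n. now rewrite HY.
  - apply ce_sigma1. apply sigma1_iff with (fun z => exists n j,
      pi2 z = scode (bits n j) /\ S j <= 2 ^ n /\ fcyl (E (pi1 z)) n j).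
    + do 2 apply sigma1_ex. repeat apply sigma1_and.
      * apply sigma1_eq; cpt. apply computable_scode_bits; cpt.
      * apply sigma1_le; cpt.
      * apply sigma1_fcyl; cpt.
    + intros z. split.
      * intros [i [s [-> Hs]]]. exists (length s), (lnum s).
        rewrite pi1_pair, pi2_pair, bits_lnum.
        split; auto. split; [apply num_lt|].
        apply cyl_opn; [apply num_lt|]. now apply cyl_sub_lnum.
      * intros [n [j [Hz [Hj HC]]]]. exists (pi1 z), (bits n j).
        rewrite <- Hz, pair_pi. split; auto.
        apply cyl_sub_bits; auto. now apply cyl_opn.
Qed.

(** * A universal Martin-Löf test *)

Lemma bits_mod n t j : n <= t -> bits n (j mod 2 ^ t) = bits n j.
Proof.
  intros H. unfold bits. apply map_ext_in. intros k Hk. apply in_seq in Hk.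
  apply Nat.mod_pow2_bits_low. lia.
Qed.

Lemma sum_count p N :
  sum (fun j => Nat.b2n (p j)) N = count (fun j => p j = true) N.
Proof.
  induction N as [|N IH]; simpl; auto. rewrite IH. f_equal.
  destruct (p N) eqn:E.
  - now rewrite (proj2 (dec_true _)).
  - destruct (dec (false = true)) eqn:D; auto.
    apply -> dec_true in D. discriminate.
Qed.

Section UniversalTest.

Variable H : nat -> nat -> nat -> bool.
Hypothesis H_computable :
  computable_pred (fun z => H (pi1 z) (pi1 (pi2 z)) (pi2 (pi2 z))).
Hypothesis H_universal : forall e : code, exists c, forall n,
  (exists v, eval (fun _ => false) e n v) <-> exists t, H c n t = true.

(** Stage [t] of component [i] of the [e]-th program. A single bound limits prefix length and
    halting witness, so a stage is a decidable union of cylinders of length [t]. *)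
Definition hits (e i t j : nat) : bool :=
  bex (fun n => bex (fun w => H e (pair i (scode (bits n j))) w) (S t)) (S t).

Lemma hits_iff e i t j : hits e i t j = true <->
  exists n w, n <= t /\ w <= t /\ H e (pair i (scode (bits n j))) w = true.
Proof.
  unfold hits. rewrite bex_spec. split.
  - intros [n [Hn HB]]. apply bex_spec in HB. destruct HB as [w [Hw HB]].
    exists n, w. repeat split; auto; lia.
  - intros [n [w [Hn [Hw HB]]]]. exists n. split; [lia|]. apply bex_spec.
    exists w. split; auto. lia.
Qed.

(* The [t]-th stage of the [i]-th component of the [e]-th test is kept only if
   its measure is at most [2^-i]; an actual test loses nothing. *)
Definition small (e i t : nat) : bool :=
  sum (fun j => Nat.b2n (hits e i t j)) (2 ^ t) * 2 ^ i <=? 2 ^ t.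

(** The shift to component [i + e + 1] makes the contributions sum to at most $\sum_e 2^{-(i+e+1)} =
    2^{-i}$; [n] is at once the stage and the string length. *)
Definition univ (i n j : nat) : Prop :=
  exists e, small e (i + e + 1) n = true /\ hits e (i + e + 1) n j = true.

Lemma hits_mono e i t t' j :
  t <= t' -> hits e i t (j mod 2 ^ t) = true -> hits e i t' (j mod 2 ^ t') = true.
Proof.
  intros L. rewrite !hits_iff. intros [n [w [Hn [Hw HB]]]].
  exists n, w. repeat split; try lia. rewrite bits_mod in * by lia. exact HB.
Qed.

Lemma computable_pred_hits e i t j :
  computable e -> computable i -> computable t -> computable j ->
  computable_pred (fun x => hits (e x) (i x) (t x) (j x)).
Proof.
  intros He Hi Ht Hj. unfold hits.
  apply (computable_pred_bex (fun x n => bex (fun w =>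
    H (e x) (pair (i x) (scode (bits n (j x)))) w) (S (t x)))); cpt.
  apply (computable_pred_bex (fun z w =>
    H (e (pi1 z)) (pair (i (pi1 z)) (scode (bits (pi2 z) (j (pi1 z))))) w)); cpt.
  apply computable_pred_ext with
    (fun z => (fun u => H (pi1 u) (pi1 (pi2 u)) (pi2 (pi2 u)))
      (pair (e (pi1 (pi1 z))) (pair (pair (i (pi1 (pi1 z)))
        (scode (bits (pi2 (pi1 z)) (j (pi1 (pi1 z)))))) (pi2 z)))).
  - apply (computable_pred_comp _ _ H_computable). cpt.
    apply computable_scode_bits; cpt.
  - intros z. now rewrite !pi2_pair, !pi1_pair.
Qed.

Lemma sigma1_univ : sigma1_3 univ.
Proof.
  unfold sigma1_3, univ. sig; apply sigma1_pred.
  - apply computable_pred_leb; cpt.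
    apply (computable_sum (fun z j => Nat.b2n (hits (pi2 z)
      (pi1 (pi1 z) + pi2 z + 1) (pi1 (pi2 (pi1 z))) j))); cpt.
    apply (computable_pred_hits (fun z => pi2 (pi1 z))
      (fun z => pi1 (pi1 (pi1 z)) + pi2 (pi1 z) + 1)
      (fun z => pi1 (pi2 (pi1 (pi1 z)))) pi2); cpt.
  - apply computable_pred_hits; cpt.
Qed.

(** Stages increase, so all small stages below [M] lie inside the last small one, whose measure is
    bounded by the definition of [small]. *)
Lemma count_small_hits e i N M :
  M <= S N ->
  count (fun J => exists m, m < M /\
    small e i m = true /\ hits e i m (J mod 2 ^ m) = true) (2 ^ N) * 2 ^ i <= 2 ^ N.
Proof.
  induction M as [|M IH]; intros HM.
  - rewrite count_none; [lia|]. intros j _ [m [Hm _]]. lia.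
  - destruct (small e i M) eqn:S.
    + apply Nat.leb_le in S. rewrite sum_count in S.
      assert (L : count (fun J => exists m, m < Datatypes.S M /\
          small e i m = true /\ hits e i m (J mod 2 ^ m) = true) (2 ^ N) <=
        2 ^ (N - M) * count (fun j => hits e i M j = true) (2 ^ M)).
      { rewrite <- count_mod_pow2 by lia. apply count_mono.
        intros j _ [m [Hm [_ HB]]]. revert HB. apply hits_mono. lia. }
      eapply Nat.le_trans; [apply Nat.mul_le_mono_r, L|].
      rewrite <- Nat.mul_assoc.
      eapply Nat.le_trans; [apply Nat.mul_le_mono_l, S|].
      rewrite <- Nat.pow_add_r. now replace (N - M + M) with N by lia.
    + eapply Nat.le_trans; [|apply IH; lia]. apply Nat.mul_le_mono_r, count_mono.
      intros j _ [m [Hm [HS HB]]]. exists m. repeat split; auto.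
      enough (m <> M) by lia. congruence.
Qed.

(** Two finiteness steps reduce the bound to [count_geometric]: one level [N] covers all included
    cylinders of length [n], and finitely many programs account for the strings of length [N]. *)
Lemma measure_univ i : measure_le_pow2 (opn (univ i)) i.
Proof.
  apply measure_le_count. intros n.
  destruct (finite_bound (fun j N => cyl (opn (univ i)) n j -> n <= N /\
    forall J, J < 2 ^ N -> J mod 2 ^ n = j -> covered (univ i) N J) (2 ^ n))
    as [B HB].
  { intros j Hj. destruct (classic (cyl (opn (univ i)) n j)) as [HC|HC].
    - apply cyl_opn in HC; auto. destruct HC as [N HN]. now exists N.
    - now exists 0. }
  set (N := B + n).
  assert (HN : forall J, J < 2 ^ N -> cyl (opn (univ i)) n (J mod 2 ^ n) ->
    covered (univ i) N J).
  { intros J HJ HC.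
    destruct (HB (J mod 2 ^ n)) as [N' [HN' HJ']].
    - apply Nat.mod_upper_bound, pow2_pos.
    - destruct (HJ' HC) as [HL HJ2].
      apply covered_mono with N'; [unfold N; lia|]. apply HJ2.
      + apply Nat.mod_upper_bound, pow2_pos.
      + now rewrite mod_mod_pow2. }
  set (P := fun e J => exists m, m < S N /\
    small e (i + e + 1) m = true /\ hits e (i + e + 1) m (J mod 2 ^ m) = true).
  destruct (finite_bound (fun J e => cyl (opn (univ i)) n (J mod 2 ^ n) -> P e J)
    (2 ^ N)) as [M HM].
  { intros J HJ. destruct (classic (cyl (opn (univ i)) n (J mod 2 ^ n))) as [HC|HC].
    - destruct (HN J HJ HC) as [m [Hm [e [He1 He2]]]].
      exists e. intros _. exists m. split; auto. lia.
    - now exists 0. }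
  pose proof (count_geometric P i M (2 ^ N)
    (fun e _ => count_small_hits e (i + e + 1) N (S N) (le_n _))) as G.
  assert (L : count (fun J => cyl (opn (univ i)) n (J mod 2 ^ n)) (2 ^ N) <=
    count (fun J => exists e, e < M /\ P e J) (2 ^ N)).
  { apply count_mono. intros J HJ HJC. destruct (HM J HJ) as [e [He HP]]. eauto. }
  rewrite count_mod_pow2 in L by (unfold N; lia).
  set (a := count _ (2 ^ N)) in L, G. set (c := count _ (2 ^ n)) in *.
  replace (2 ^ N) with (2 ^ (N - n) * 2 ^ n) in G
    by (rewrite <- Nat.pow_add_r; f_equal; unfold N; lia).
  pose proof (pow2_pos M). pose proof (pow2_pos (N - n)).
  (* Both sides are scaled to level [N] and by the factor [2 ^ M] of the geometric bound. *)
  apply (Nat.mul_le_mono_pos_l _ _ (2 ^ (N - n))); [lia|].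
  apply (Nat.mul_le_mono_pos_r _ _ (2 ^ M)); [lia|].
  eapply Nat.le_trans; [|eapply Nat.le_trans; [|exact G]]; [|apply Nat.le_add_r].
  apply Nat.mul_le_mono_r. rewrite Nat.mul_assoc. now apply Nat.mul_le_mono_r.
Qed.

(** If [c] is the index of the program enumerating [V], then [univ i] receives component [i + c + 1]
    of [V]. Its stages lie inside that component, so they are all small and none is discarded. *)
Lemma univ_universal V X i :
  ML_test V -> (forall i, V i X) -> opn (univ i) X.
Proof.
  intros [[HO [e He]] Hm] HX. destruct (H_universal e) as [c Hc].
  assert (E : forall i n j, j < 2 ^ n ->
    (exists t, H c (pair i (scode (bits n j))) t = true) <-> cyl (V i) n j).
  { intros k n j Hj. rewrite <- Hc, <- He, <- cyl_sub_bits by auto. split.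
    - intros [k' [s [Es HC]]]. apply pair_inj in Es. destruct Es as [<- Es].
      (* Injectivity of [scode], by induction on both strings. *)
      enough (bits n j = s) as -> by auto. clear HC. revert s Es.
      generalize (bits n j) as r.
      induction r as [|a r IH]; intros [|b s] Es; simpl in Es; try easy.
      injection Es as Es. apply pair_inj in Es. destruct Es as [E1 E2].
      f_equal; auto. now destruct a, b.
    - intros HC. eauto. }
  set (k := i + c + 1).
  destruct (HO k X (HX k)) as [s [Hs HC]].
  apply prefix_num in Hs. apply cyl_sub_lnum in HC. rewrite <- Hs in HC.
  apply E in HC; [|apply num_lt]. destruct HC as [w Hw].
  (* Large enough for both the prefix length and the halting witness. *)
  set (t := length s + w).
  exists t, c. fold k. split.
  - apply Nat.leb_le. rewrite sum_count.
    eapply Nat.le_trans; [|apply (proj1 (measure_le_count _ _) (Hm k) t)].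
    apply Nat.mul_le_mono_r, count_mono. intros j Hj HB.
    apply hits_iff in HB. destruct HB as [n [v [Hn [Hv HB]]]].
    apply cyl_ext_mod with n; auto. apply E.
    + apply Nat.mod_upper_bound, pow2_pos.
    + exists v. now rewrite bits_mod.
  - apply hits_iff. exists (length s), w. repeat split; try (unfold t; lia).
    rewrite <- bits_mod with (t := length s) by auto.
    rewrite num_mod by (unfold t; lia). exact Hw.
Qed.

Definition mix (E0 : nat -> nat -> Prop) (i : nat) : nat -> nat -> Prop :=
  match i with 0 => E0 | S _ => univ i end.

(** Every set has measure at most $2^0$, so component 0 is free to be any effectively open set;
    containing component 1 keeps the test universal. *)
Lemma mix_universal E0 :
  sigma1 (fun z => E0 (pi1 z) (pi2 z)) ->
  (forall X, opn (univ 1) X -> opn E0 X) ->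
  universal_ML_test (fun i => opn (mix E0 i)).
Proof.
  intros S0 HE0. split; [split|].
  - apply unif_eff_open_opn. unfold sigma1_3.
    apply sigma1_iff with (fun z => pi1 z = 0 /\ E0 (pi1 (pi2 z)) (pi2 (pi2 z)) \/
      exists i, pi1 z = S i /\ univ (pi1 z) (pi1 (pi2 z)) (pi2 (pi2 z))).
    + apply sigma1_or; [|apply sigma1_ex]; apply sigma1_and; try (apply sigma1_eq; cpt).
      * apply (sigma1_subst _ pi2 S0). cpt.
      * apply (sigma1_subst3 univ); [apply sigma1_univ|cpt..].
    + intros z. destruct (pi1 z) as [|i]; simpl; split.
      * auto.
      * intros [[_ HE]|[i [? _]]]; [auto|discriminate].
      * eauto.
      * intros [[? _]|[i' [_ HE]]]; [discriminate|auto].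
  - intros [|i]; [|apply measure_univ].
    apply measure_le_count. intros n.
    rewrite <- (count_all (fun _ => True) (2 ^ n)) at 2 by auto.
    rewrite Nat.mul_1_r. now apply count_mono.
  - intros V HV X HX [|i].
    + apply HE0. now apply (univ_universal V).
    + now apply (univ_universal V).
Qed.

End UniversalTest.

(** * First surviving extensions *)

(* Among the extensions of [s] of length [2 |s| + 2], those preceded only by
   extensions inside [opn E]. Outside [opn E] at most one is left for each [s],
   so that these sets add measure at most [sum_k 2^k 2^-(2k+2) = 1/2], and
   strictly less at every finite level. *)
Definition first_ext (E : nat -> nat -> Prop) (n j : nat) : Prop :=
  exists k, n = 2 * k + 2 /\
    forall i, i < j -> i mod 2 ^ k = j mod 2 ^ k -> fcyl E n i.

Lemma sigma1_first_ext E :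
  sigma1_3 E -> sigma1 (fun z => first_ext (E 1) (pi1 z) (pi2 z)).
Proof.
  intros HE. unfold first_ext.
  apply sigma1_ex, sigma1_and; [sig|].
  apply sigma1_all, sigma1_imp_eq; cpt; try (apply computable_mod_pow2; cpt).
  apply (sigma1_fcyl E (fun _ => 1)); cpt.
Qed.

(** If the two open sets covered everything, compactness would give a level [N] at which counting
    strings contradicts the measure bounds. *)
Lemma first_ext_not_full E :
  measure_le_pow2 (opn E) 1 -> exists X, ~ opn E X /\ ~ opn (first_ext E) X.
Proof.
  intros HE. apply NNPP. intros HN.
  destruct (compactness (fun n j => E n j \/ first_ext E n j)) as [N HC].
  { intros X. apply NNPP. intros HX. apply HN. exists X.
    split; intros [n Hn]; apply HX; eauto. }
  (* The candidates that really survive; restriction to [k] bits is injective on them. *)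
  set (FS := fun k j => ~ fcyl E (2 * k + 2) j /\
    forall i, i < j -> i mod 2 ^ k = j mod 2 ^ k -> fcyl E (2 * k + 2) i).
  assert (HFS : forall k, count (FS k) (2 ^ (2 * k + 2)) <= 2 ^ k).
  { intros k. apply count_inj with (fun j => j mod 2 ^ k).
    - intros j _ _. apply Nat.mod_upper_bound, pow2_pos.
    - intros i j _ _ [Hi1 Hi2] [Hj1 Hj2] Eij.
      destruct (Nat.lt_trichotomy i j) as [L|[L|L]]; auto.
      + elim Hi1. auto.
      + elim Hj1. auto. }
  assert (H1 : forall J, J < 2 ^ N -> cyl (opn E) N J \/
    exists k, k < N /\ 2 * k + 2 <= N /\ FS k (J mod 2 ^ (2 * k + 2))).
  { intros J HJ. destruct (HC J HJ) as [n [Hn [HEn|HF]]].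
    - left. apply cyl_ext_mod with n; auto. intros X HX. exists n. now rewrite HX.
    - destruct HF as [k [-> HF]].
      destruct (classic (fcyl E (2 * k + 2) (J mod 2 ^ (2 * k + 2)))) as [HD|HD].
      + left. apply cyl_ext_mod with (2 * k + 2); auto. apply cyl_opn; auto.
        apply Nat.mod_upper_bound, pow2_pos.
      + right. exists k. split; [lia|]. split; auto. split; auto. }
  pose proof (count_all _ _ H1) as H2.
  pose proof (count_or (cyl (opn E) N) (fun J => exists k, k < N /\
    2 * k + 2 <= N /\ FS k (J mod 2 ^ (2 * k + 2))) (2 ^ N)) as H3.
  pose proof (proj1 (measure_le_count _ _) HE N) as H4.
  (* At most $2^k$ survivors among $2^{2k+2}$ strings have weight at most $2^{-(k+2)}$, the form
     required by [count_geometric] with [i = 1]. *)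
  assert (H5 : forall k, k < N -> count (fun J => 2 * k + 2 <= N /\
    FS k (J mod 2 ^ (2 * k + 2))) (2 ^ N) * 2 ^ (1 + k + 1) <= 2 ^ N).
  { intros k _. destruct (le_dec (2 * k + 2) N) as [L|L].
    - rewrite count_ext with (Q := fun J => FS k (J mod 2 ^ (2 * k + 2))) by tauto.
      rewrite count_mod_pow2 by auto.
      replace (2 ^ N) with (2 ^ (N - (2 * k + 2)) * 2 ^ k * 2 ^ (1 + k + 1))
        by (rewrite <- !Nat.pow_add_r; f_equal; lia).
      apply Nat.mul_le_mono_r, Nat.mul_le_mono_l, HFS.
    - rewrite count_none; [lia|tauto]. }
  pose proof (count_geometric _ 1 N (2 ^ N) H5) as H6.
  cbv beta in H3. rewrite H2 in H3. set (a := count _ (2 ^ N)) in H3, H4.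
  cbv beta in H6. set (b := count _ (2 ^ N)) in H3, H6.
  (* Here [2 * a <= 2 ^ N] but [2 * b < 2 ^ N], the series being finite, while [a + b] should reach
     [2 ^ N]. *)
  rewrite Nat.pow_1_r in *. pose proof (pow2_pos N). nia.
Qed.

(** Among the extensions of the first [k] bits of [X], the least uncovered one of length [2 * k + 2]
    satisfies [first_ext], and its cylinder contains a point outside [opn E]. *)
Lemma first_ext_limit E X k :
  ~ opn E X ->
  exists Y, (forall m, m < k -> Y m = X m) /\ ~ opn E Y /\ opn (first_ext E) Y.
Proof.
  intros HX.
  destruct (dec_inh_nat_subset_has_unique_least_element
    (fun j => j < 2 ^ (2 * k + 2) /\ j mod 2 ^ k = num X k /\
      ~ fcyl E (2 * k + 2) j)) as [j [[[Hj [Hm HF]] Hleast] _]].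
  - intros n. apply classic.
  - exists (num X (2 * k + 2)). split; [apply num_lt|].
    split; [apply num_mod; lia|]. intros HC. apply HX.
    apply cyl_opn in HC; [|apply num_lt]. now apply HC.
  - rewrite <- cyl_opn in HF by auto.
    apply not_all_ex_not in HF. destruct HF as [Y HY].
    apply imply_to_and in HY. destruct HY as [HY HYE].
    exists Y. repeat split; auto.
    + apply num_inj. rewrite <- Hm, <- HY. symmetry. apply num_mod. lia.
    + exists (2 * k + 2), k. split; auto. rewrite HY.
      intros i Hi Ei. apply NNPP. intros HC.
      enough (j <= i) by lia. apply Hleast. repeat split; auto; lia.
Qed.

(** * Discontinuity on a layer *)

(** The use principle: a halting computation queries finitely many oracle bits. For [Mu], the uses
    of the finitely many earlier tests are bounded together. *)
Lemma eval_use O e : forall x v, eval O e x v ->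
  exists N, forall O', (forall k, k < N -> O' k = O k) -> eval O' e x v.
Proof.
  induction e; intros x v Hv.
  1-5: exists 0; intros O' _; inversion Hv; subst; constructor.
  - inversion Hv; subst. exists (S x). intros O' HO'.
    rewrite <- HO' by lia. constructor.
  - inversion Hv as [| | | | | |f g x0 a b H1 H2| | | |]; subst.
    destruct (IHe1 _ _ H1) as [N1 HN1], (IHe2 _ _ H2) as [N2 HN2].
    exists (N1 + N2). intros O' HO'.
    constructor; [apply HN1|apply HN2]; intros; apply HO'; lia.
  - inversion Hv as [| | | | | | |f g x0 y z H1 H2| | |]; subst.
    destruct (IHe2 _ _ H1) as [N1 HN1], (IHe1 _ _ H2) as [N2 HN2].
    exists (N1 + N2). intros O' HO'.
    apply ev_comp with y; [apply HN1|apply HN2]; intros; apply HO'; lia.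
  - rewrite <- (pair_pi x) in *. revert v Hv.
    generalize (pi1 x) as a. generalize (pi2 x) as n.
    induction n as [|n IHn]; intros a v Hv; apply eval_prec_inv in Hv.
    + destruct (IHe1 _ _ Hv) as [N HN]. exists N. intros O' HO'.
      constructor. auto.
    + destruct Hv as [y [H1 H2]].
      destruct (IHn _ _ H1) as [N1 HN1], (IHe2 _ _ H2) as [N2 HN2].
      exists (N1 + N2). intros O' HO'.
      apply ev_precS with y; [apply HN1|apply HN2]; intros; apply HO'; lia.
  - inversion Hv as [| | | | | | | | | |f y n H1 H2]; subst.
    destruct (IHe _ _ H1) as [N1 HN1].
    destruct (finite_bound (fun m N => exists w, w <> 0 /\
      forall O', (forall k, k < N -> O' k = O k) -> eval O' e (pair x m) w) v)
      as [B HB].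
    { intros m Hm. destruct (H2 m Hm) as [w [Hw Hw']].
      destruct (IHe _ _ Hw') as [N HN]. eauto. }
    exists (N1 + B). intros O' HO'. constructor.
    + apply HN1. intros. apply HO'. lia.
    + intros m Hm. destruct (HB m Hm) as [N [HN [w [Hw Hw']]]].
      exists w. split; auto. apply Hw'. intros. apply HO'. lia.
Qed.

Lemma universal_MLR U X i : universal_ML_test U -> ~ U i X -> MLR X.
Proof. intros [_ HU] HX V HV HVX. apply HX. now apply (HU V). Qed.

Lemma rd_unique U X i j : rd U X i -> rd U X j -> i = j.
Proof.
  intros [Hi Hi'] [Hj Hj'].
  destruct (Nat.lt_trichotomy i j) as [L|[L|L]]; auto.
  - elim Hi. auto.
  - elim Hj. auto.
Qed.

Lemma rd_exactly_layerwise_computable U :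
  exactly_layerwise_computable U (fun X k => dec (rd U X k)).
Proof.
  (* The values of the function form the characteristic function of the deficiency, which the oracle
     already holds at its odd positions. *)
  assert (C : computable (fun k => k + k + 1))
    by (repeat apply computable_add; cpt).
  destruct C as [e He]. exists (Comp Orc e). intros X _ i Hi k.
  apply ev_comp with (k + k + 1); [apply He|].
  replace (dec (rd U X k)) with (join X (nat_code i) (k + k + 1)); [constructor|].
  replace (k + k + 1) with (S (2 * k)) by lia.
  unfold join, nat_code. rewrite Nat.even_succ, Nat.odd_even, Nat.div2_succ_double.
  apply eq_true_iff_eq. rewrite Nat.eqb_eq, dec_true. split.
  - now intros ->.
  - intros Hk. apply (rd_unique U X); auto.
Qed.

Theorem theorem4p10 :
  exists (U W : nat -> Cantor -> Prop) (F : Cantor -> Cantor),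
    universal_ML_test U /\ universal_ML_test W /\
    exactly_layerwise_computable U F /\ ~ exactly_layerwise_computable W F.
Proof.
  destruct universal_halting as [H [HC HU]].
  set (T := univ H 1).
  set (U := fun i => opn (mix H (fun n j => T n j \/ first_ext T n j) i)).
  set (W := fun i => opn (mix H (fun _ _ => True) i)).
  pose proof (sigma1_univ H HC) as S1.
  assert (UW : universal_ML_test W).
  { apply mix_universal; auto.
    - apply sigma1_iff with (fun _ => 0 = 0); [sig|easy].
    - intros X _. now exists 0. }
  exists U, W, (fun X k => dec (rd U X k)). split; [|split; [|split]]; auto.
  - apply mix_universal; auto.
    + apply sigma1_or.
      * apply (sigma1_subst3 (univ H) (fun _ => 1)); cpt.
      * now apply (sigma1_first_ext (univ H)).
    + intros X [n Hn]. exists n. auto.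
  - apply rd_exactly_layerwise_computable.
  - intros [e He].
    destruct (first_ext_not_full T (measure_univ H 1)) as [X [HX HX']].
    (* Outside [opn T], the deficiency for [W] is 1 because [W 0] is the whole space. With this
       fixed advice, bit 0 of the output tells whether the deficiency for [U] is 0. *)
    assert (W1 : forall Y, ~ opn T Y -> eval (join Y (nat_code 1)) e 0
      (if dec (rd U Y 0) then 1 else 0)).
    { intros Y HY. apply He.
      - now apply (universal_MLR W Y 1).
      - split; auto. intros [|j] Hj; [now exists 0|lia]. }
    (* Continuity at [X]: a point [Y] agreeing with [X] below the use must get the same answer, yet
       [Y] lies in [U 0] and [X] does not. *)
    destruct (eval_use _ _ _ _ (W1 X HX)) as [N HN].
    destruct (first_ext_limit T X N HX) as [Y [HYX [HY HYF]]].
    assert (EX : dec (rd U X 0) = true).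
    { apply dec_true. split; [|lia]. intros [n [Hn|Hn]]; [apply HX|apply HX'];
        now exists n. }
    assert (EY : dec (rd U Y 0) <> true).
    { rewrite dec_true. intros [HU0 _]. apply HU0. destruct HYF as [n Hn].
      exists n. simpl. auto. }
    apply not_true_is_false in EY.
    specialize (W1 Y HY). rewrite EY in W1. rewrite EX in HN.
    enough (HJ : forall k, k < N -> join Y (nat_code 1) k = join X (nat_code 1) k)
      by discriminate (eval_det _ _ _ _ _ (HN _ HJ) W1).
    (* Odd positions hold the same advice; an even position [k] reads bit [k / 2], which is below
       [N]. *)
    intros k Hk. unfold join. destruct (Nat.even k); auto.
    apply HYX. pose proof (Nat.div2_odd k). lia.
Qed.
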